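(* Let $J\subset\mathbb R$ be a compact interval with nonempty interior and let $\varepsilon>0$. Then the diagonal singleton exact spectral problem and the diagonal singleton fixed-$\varepsilon$ pseudospectral problem are raw finite-query equivalent: $$\mathcal P^{\sigma}_{J,\mathrm{diag}}\equiv_{\mathrm{raw},\mathrm{fq}}\mathcal P^{\sigma_\varepsilon}_{J,\varepsilon,\mathrm{diag}},$$ i.e. $\mathcal P^{\sigma}_{J,\mathrm{diag}}\le_{\mathrm{raw},\mathrm{fq}}\mathcal P^{\sigma_\varepsilon}_{J,\varepsilon,\mathrm{diag}}$ and $\mathcal P^{\sigma_\varepsilon}_{J,\varepsilon,\mathrm{diag}}\le_{\mathrm{raw},\mathrm{fq}}\mathcal P^{\sigma}_{J,\mathrm{diag}}$. Moreover, both reductions can be realized with all finite-transcript reconstruction maps $\vartheta_f$ continuous.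
   Context: $\mathbb N=\{1,2,\dots\}$, $\mathbb N_0=\{0,1,2,\dots\}$. SCI computational problem: a tuple $\mathcal P=(\Xi,\Omega,(\mathcal M,d),\Lambda)$ where $\Omega$ is a set of instances, $(\mathcal M,d)$ is a metric space, $\Xi:\Omega\to\mathcal M$ is the target map, and $\Lambda$ is a set of functions $\Omega\to\mathbb C$ (evaluations) such that $\Xi(A)\neq\Xi(B)$ implies $f(A)\ne f(B)$ for some $f\in\Lambda$. Raw finite-query reduction: for $\mathcal S=(\Psi,\Sigma,(\mathcal N,\rho),\Lambda_{\mathcal S})$ and $\mathcal P=(\Xi,\Omega,(\mathcal M,d),\Lambda_{\mathcal P})$ write $\mathcal S\le_{\mathrm{raw},\mathrm{fq}}\mathcal P$ if there are an arbitrary map $E:\Sigma\to\Omega$, a continuous map $D:\mathcal M\to\mathcal N$, and for every $f\in\Lambda_{\mathcal P}$ a number $m_f\in\mathbb N_0$, evaluations $\gamma_{f,1},\dots,\gamma_{f,m_f}\in\Lambda_{\mathcal S}$ and a map $\vartheta_f:\operatorname{im}(\gamma_{f,1},\dots,\gamma_{f,m_f})\to\operatorname{im}(f)$ (here $\operatorname{im}(\gamma_{f,1},\dots,\gamma_{f,m_f})=\{(\gamma_{f,1}(A),\dots,\gamma_{f,m_f}(A)):A\in\Sigma\}$, a one-point set if $m_f=0$), such that for all $A\in\Sigma$: $D(\Xi(E(A)))=\Psi(A)$ and $f(E(A))=\vartheta_f(\gamma_{f,1}(A),\dots,\gamma_{f,m_f}(A))$ for all $f\in\Lambda_{\mathcal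 P}$. Continuity of $\vartheta_f$ is with respect to the subspace topologies from $\mathbb C^{m_f}$ and $\mathbb C$. Diagonal operators: $\Omega_{\mathrm{diag}}$ is the class of maximal closed diagonal operators on $\ell^2(\mathbb N)$: for a sequence $(a_j)_{j\in\mathbb N}\subset\mathbb C$, $\mathcal D(A)=\{x\in\ell^2(\mathbb N):(a_jx_j)_j\in\ell^2(\mathbb N)\}$ and $(Ax)_j=a_jx_j$. Singleton windows: $\mathcal K_{\mathrm{sgl}}(J)=\{\{z\}:z\in J\}$; for each $K=\{z\}$ rational approximants $r_n(K)\in\mathbb Q+i\mathbb Q$, $n\in\mathbb N$, with $|r_n(K)-z|\le2^{-(n+1)}$ are fixed once and for all. Interface: $\Lambda_{\mathrm{diag}}=\{\mu_j:j\in\mathbb N\}\cup\{\rho_n:n\in\mathbb N\}$ with $\mu_j(A,K)=a_j$ (where $Ae_j=a_je_j$) and $\rho_n(A,K)=r_n(K)$. Pseudospectrum: $\sigma_\varepsilon(A)=\overline{\{z\in\mathbb C:\|(A-zI)^{-1}\|>\varepsilon^{-1}\}}$, with $\|(A-zI)^{-1}\|=\infty$ for $z\in\sigma(A)$. Problems: $\mathcal P^{\sigma}_{J,\mathrm{diag}}=(\Xi_\sigma,\Omega_{\mathrm{diag}}\times\mathcal K_{\mathrm{sgl}}(J),(\{0,1\},d_{\mathrm{disc}}),\Lambda_{\mathrm{diag}})$ with $\Xi_\sigma(A,K)=1$ if $\sigma(A)\cap K=\varnothing$ and $0$ otherwise; $\mathcal P^{\sigma_\varepsilon}_{J,\varepsilon,\mathrm{diag}}$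 is the same with target $\Xi_{\sigma_\varepsilon}(A,K)=1$ if $\sigma_\varepsilon(A)\cap K=\varnothing$ and $0$ otherwise. Here $d_{\mathrm{disc}}$ is the discrete metric. *)

(* Defs.v *)
From HB Require Import structures.
From mathcomp Require Import all_boot all_order all_algebra.
From mathcomp Require Import all_classical all_reals all_analysis.
From mathcomp Require Import complex.

Set Implicit Arguments.
Unset Strict Implicit.
Unset Printing Implicit Defensive.

Import Order.TTheory GRing.Theory Num.Theory.
Import numFieldNormedType.Exports.
Import ComplexField.Normc.

Local Open Scope classical_set_scope.
Local Open Scope complex_scope.
Local Open Scope ring_scope.

(* The regular-module alias [^o] is what carries the topology of [R[i]]. *)
Notation Cplx R := (R[i]^o) (only parsing).

Record sci_problem (R : realType) := SciProblem {
  instances : Type;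
  target_space : metricType R;
  target : instances -> target_space;
  evaluations : set (instances -> Cplx R);
  evaluations_separate : forall A B, target A <> target B ->
    exists2 f, evaluations f & f A <> f B }.

Section RawReduction.
Variable R : realType.
Local Notation C := (Cplx R).

Definition transcript (T : Type) (m : nat) (query : 'I_m -> T -> C) (A : T)
  : 'rV[C]_m := \row_i query i A.

(* The reconstruction map is a total function on [C^m], but only its values on
   the set of attained transcripts matter. *)
Record reconstruction (S : sci_problem R) (Omega : Type)
    (E : instances S -> Omega) (f : Omega -> C) := Reconstruction {
  nqueries : nat;
  query : 'I_nqueries -> instances S -> C;
  query_evaluation : forall i, evaluations (query i);
  theta : 'rV[C]_nqueries -> C;
  theta_image : set_fun (range (transcript query)) (range f) theta;
  thetaE : forall A, f (E A) = theta (transcript query A) }.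

Arguments query {S Omega E f} r : rename.
Arguments theta {S Omega E f} r : rename.

Record raw_fq_reduction (S P : sci_problem R) := RawFqReduction {
  instance_map : instances S -> instances P;
  target_map : target_space P -> target_space S;
  target_map_continuous : continuous target_map;
  target_mapE : forall A, target_map (target (instance_map A)) = target A;
  reconstruct : forall f, evaluations f -> reconstruction instance_map f }.

Definition continuous_transcripts (S P : sci_problem R)
    (red : raw_fq_reduction S P) : Prop :=
  forall f (Lf : evaluations f), let rc := reconstruct red Lf in
  {within range (transcript (query rc)), continuous (theta rc)}.

Definition raw_fq_le (S P : sci_problem R) : Prop :=
  inhabited (raw_fq_reduction S P).

Definition raw_fq_equiv (S P : sci_problem R) : Prop :=
  raw_fq_le S P /\ raw_fq_le P S.

Definition raw_fq_le_continuous (S P : sci_problem R) : Prop :=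
  exists red : raw_fq_reduction S P, continuous_transcripts red.

End RawReduction.

Arguments query {R S Omega E f} r _ _ : rename.
Arguments theta {R S Omega E f} r _ : rename.

(* The two-point space {0, 1} with the discrete metric.  The library's
   pseudometric on [bool] has singletons as balls of every radius, hence does
   not come from a distance, whence a separate alias. *)
Definition zero_one (R : realType) : Type := bool.

Section ZeroOne.
Variable R : realType.

HB.instance Definition _ := Choice.copy (zero_one R) bool.

Let d_disc (x y : zero_one R) : R := (x != y)%:R.

Let d_discxx x : d_disc x x = 0.
Proof. by rewrite /d_disc eqxx. Qed.

Let d_disc_positivity x y : d_disc x y = 0 -> x = y.
Proof. by rewrite /d_disc; case: eqP => // _ /eqP; rewrite oner_eq0. Qed.

Let d_disc_sym x y : d_disc x y = d_disc y x.
Proof. by rewrite /d_disc eq_sym. Qed.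

Let d_disc_triangle y x z : d_disc x z <= d_disc x y + d_disc y z.
Proof. by rewrite /d_disc -natrD ler_nat; case: x y z => [] [] []. Qed.

HB.instance Definition _ := isMetric.Build R (zero_one R)
  d_discxx d_disc_positivity d_disc_sym d_disc_triangle.

End ZeroOne.

Section Operators.
Variable R : realType.
Local Notation C := (Cplx R).

(* The index set {1, 2, ...} of l^2 is relabelled as [nat]. *)
Definition l2sum (x : nat -> C) : \bar R :=
  (\sum_(0 <= j <oo) (normc (x j) ^+ 2)%:E)%E.

Definition ell2 : set (nat -> C) := [set x | (l2sum x < +oo)%E].

Definition l2norm (x : nat -> C) : R := Num.sqrt (fine (l2sum x)).

(* A (partially defined) operator A is represented by its graph:
   [A (x, y)] means that x is in the domain of A and A x = y. *)
Definition operator := set ((nat -> C) * (nat -> C)).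

(* x in l^2 belongs to the domain exactly when (a_j x_j)_j is in l^2. *)
Definition diag_op (a : nat -> C) : operator :=
  [set p | [/\ ell2 p.1, ell2 p.2 & forall j, p.2 j = a j * p.1 j]].

(* A - z I: (x, w) is in its graph iff A x = w + z x. *)
Definition shift_op (A : operator) (z : C) : operator :=
  [set p | A (p.1, fun j => p.2 j + z * p.1 j)].

Definition inverse_op (A : operator) : operator := [set p | A (p.2, p.1)].

Definition resolvent (A : operator) (z : C) : operator :=
  inverse_op (shift_op A z).

Definition bounded_everywhere (B : operator) : Prop :=
  (forall w, ell2 w -> exists! x, B (w, x)) /\
  (exists M : R, forall w x, B (w, x) -> l2norm x <= M * l2norm w).

Definition opnorm (B : operator) : \bar R :=
  ereal_sup [set (l2norm p.2)%:E | p in [set p | B p /\ l2norm p.1 <= 1]].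

Definition spectrum (A : operator) : set C :=
  [set z | ~ bounded_everywhere (resolvent A z)].

Definition resolvent_norm (A : operator) (z : C) : \bar R :=
  if `[< spectrum A z >] then +oo%E else opnorm (resolvent A z).

Definition pseudospectrum (eps : R) (A : operator) : set C :=
  closure [set z | (eps^-1%:E < resolvent_norm A z)%E].

Definition Omega_diag : set operator := range diag_op.

Definition basis_vector (j : nat) : nat -> C := fun k => (k == j)%:R.

(* The c such that A e_j = c e_j. *)
Definition diag_entry (j : nat) (A : operator) : C :=
  xget 0 [set c | A (basis_vector j, fun k => c * basis_vector j k)].

Lemma ell2_scaled_basis (c : C) (j : nat) :
  ell2 (fun k => c * basis_vector j k).
Proof.
rewrite /ell2/= /l2sum (nneseries_split 0 j.+1); last first.
  by move=> k _; rewrite lee_fin sqr_ge0.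
rewrite add0n [X in (_ + X)%E]eseries0 ?adde0; last first.
  move=> k jk _; rewrite /basis_vector (gtn_eqF jk) mulr0.
  by rewrite normc0 expr0n.
by rewrite sumEFin ltry.
Qed.

Lemma ell2_basis (j : nat) : ell2 (basis_vector j).
Proof.
by have := ell2_scaled_basis 1 j; congr ell2; apply/funext => k; rewrite mul1r.
Qed.

Lemma diag_entryE (a : nat -> C) (j : nat) : diag_entry j (diag_op a) = a j.
Proof.
apply: xget_unique => /=.
  split; [exact: ell2_basis | exact: ell2_scaled_basis |] => k /=.
  rewrite /basis_vector; case: eqP => [->//|_]; by rewrite !mulr0.
by move=> c [_ _ /(_ j)] /=; rewrite /basis_vector eqxx !mulr1.
Qed.

End Operators.

Lemma normc_triangle (R : rcfType) (c x y : R[i]) :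
  normc (x - y) <= normc (c - x) + normc (c - y).
Proof.
have -> : x - y = (c - y) - (c - x) by rewrite opprB [RHS]addrC addrA subrK.
by rewrite (le_trans (le_normcD _ _))// normcN addrC.
Qed.

Section DiagonalProblems.
Variables (R : realType) (J : set R).
Local Notation C := (Cplx R).

Definition K_sgl : set (set C) := [set [set x%:C] | x in J].

(* Indices n >= 1 only; the value at n = 0 is irrelevant. *)
Record sgl_approximants := SglApproximants {
  sgl_approx :> K_sgl -> nat -> C;
  sgl_approx_rational : forall K n, (0 < n)%N ->
    exists p q : rat, sgl_approx K n = (ratr p +i* ratr q);
  sgl_approx_close : forall (K : K_sgl) n (z : C), (0 < n)%N -> val K = [set z] ->
    normc (sgl_approx K n - z) <= 2 ^- n.+1 }.

Variable r : sgl_approximants.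

Local Notation inst := (@Omega_diag R * K_sgl)%type.

Definition mu (j : nat) (p : inst) : C := diag_entry j (val p.1).

Definition rho (n : nat) (p : inst) : C := r p.2 n.

Definition Lambda_diag : set (inst -> C) :=
  [set mu j | j in setT] `|` [set rho n | n in [set n | (0 < n)%N]].

(* Target 1 (= [true]) iff the window misses the set [S A]. *)
Definition avoids (S : operator R -> set C) (p : inst) : zero_one R :=
  `[< S (val p.1) `&` val p.2 = set0 >].

Lemma Lambda_diag_inj (p q : inst) :
  (forall f, Lambda_diag f -> f p = f q) ->
  val p.1 = val q.1 /\ val p.2 = val q.2.
Proof.
case: p q => [P K] [Q L] /= pq; split.
  have /set_mem[a _ aP] := valP P; have /set_mem[b _ bQ] := valP Q.
  rewrite -aP -bQ; congr diag_op; apply/funext => j.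
  rewrite -[a j]diag_entryE -[b j]diag_entryE aP bQ.
  by apply: (pq (mu j)); left; exists j.
have /set_mem[x Jx xK] := valP K; have /set_mem[y Jy yL] := valP L.
rewrite -xK -yL; congr set1; apply/eqP; rewrite -subr_eq0; apply/eqP.
apply: (@eq0_normc R); apply/eqP; rewrite eq_le; apply/andP; split; last first.
  exact: sqrtr_ge0.
apply/ler_addgt0Pr => e e0; rewrite add0r.
have [n _ ne] := @near_infty_natSinv_expn_lt R (PosNum e0).
have /= {}ne := ne n.+1 (leqnSn n).
have nK : normc (r K n.+1 - x%:C) <= 2 ^- n.+2.
  by apply: sgl_approx_close => //; rewrite -xK.
have nL : normc (r L n.+1 - y%:C) <= 2 ^- n.+2.
  by apply: sgl_approx_close => //; rewrite -yL.
have rKL : r K n.+1 = r L n.+1 by apply: (pq (rho n.+1)); right; exists n.+1.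
apply: le_trans (ltW ne); rewrite -rKL in nL.
apply: (le_trans (normc_triangle (r K n.+1) x%:C y%:C)).
apply: (le_trans (lerD nK nL)).
have -> : 2 ^- n.+2 + 2 ^- n.+2 = 2 ^- n.+1 :> R.
  by rewrite -mulr2n -[LHS]mulr_natl [in LHS]exprS invfM mulVKf.
by rewrite div1r.
Qed.

Lemma Lambda_diag_separates (S : operator R -> set C) (p q : inst) :
  avoids S p <> avoids S q -> exists2 f, Lambda_diag f & f p <> f q.
Proof.
move=> pq; apply: contrapT => nf; apply: pq.
have [|e1 e2] := @Lambda_diag_inj p q; last by rewrite /avoids e1 e2.
by move=> f Lf; apply: contrapT => fpq; apply: nf; exists f.
Qed.

Definition diag_problem (S : operator R -> set C) : sci_problem R :=
  SciProblem (@Lambda_diag_separates S).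

Definition P_sigma : sci_problem R := diag_problem (@spectrum R).

Definition P_sigma_eps (eps : R) : sci_problem R :=
  diag_problem (pseudospectrum eps).

End DiagonalProblems.

(* Main.v *)
Require Import Defs.
From mathcomp Require Import all_boot all_order all_algebra.
From mathcomp Require Import all_classical all_reals all_analysis.
From mathcomp Require Import complex ring lra.
Set Implicit Arguments.
Unset Strict Implicit.
Unset Printing Implicit Defensive.
Import Order.TTheory GRing.Theory Num.Theory.
Import numFieldNormedType.Exports.
Import ComplexField.Normc.
Local Open Scope classical_set_scope.
Local Open Scope complex_scope.
Local Open Scope ring_scope.

(** For a diagonal operator with entries (a_j), the resolvent at z is the
    diagonal operator with entries 1/(a_j - z), of norm 1/dist(z, {a_j}).
    Hence z is in the spectrum iff inf_j |a_j - z| = 0 ([spectrum_diagE]), and,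
    a closed ball being the closure of the open one, z is in the
    eps-pseudospectrum iff inf_j |a_j - z| <= eps ([pseudospectrum_diagE]).
    Both problems thus compare the distance from z to the entries with a
    threshold, 0 or eps, and each reduction keeps the window {z} and moves the
    entries so that one threshold becomes the other.

    From 0 to eps: the window z is real, so replacing c by
    c' = Re c + i (eps + |Im c|) pushes every point away from the real axis and
    gives |c' - z|^2 = |c - z|^2 + 2 eps |Im c| + eps^2.  So the distance from z
    to the new entries is at least eps, with equality iff the old distance is 0
    ([near_values_raise]).  Each new entry is a continuous function of one old
    entry, and z is not queried at all.

    From eps to 0: the new entries should approach z exactly when the excess
    max(|a_j - z| - eps, 0) has infimum 0.  As z is only known through
    approximations q_n with |q_n - z| <= 2^-(n+1), there is one new entry for
    each pair (j, n),
    Re q_n + i (max(|Re q_n - a_j| - eps, 0) + 2^-n).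
    For fixed j it tends to z plus i times the excess of a_j as n grows, and the
    margin 2^-n outweighs the approximation error, so its distance to z is never
    below |a_j - z| - eps ([near_values_excess]).  Each new entry is a continuous
    function of the two evaluations a_j and q_n.

    All reconstruction maps are restrictions of Lipschitz maps on C or C^2, or
    coordinates, hence continuous, and the decoder is the identity. *)

(** * The modulus of a complex number *)

Section ComplexModulus.
Variable R : rcfType.
Implicit Types (x y z : R[i]) (a b : R).

Lemma normc_ge0 z : 0 <= normc z.
Proof. by case: z => a b; exact: sqrtr_ge0. Qed.

Lemma normc_sqr z : normc z ^+ 2 = complex.Re z ^+ 2 + complex.Im z ^+ 2.
Proof. by case: z => a b /=; rewrite sqr_sqrtr// addr_ge0 ?sqr_ge0. Qed.

Lemma normcB x y : normc (x - y) = normc (y - x).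
Proof. by rewrite -opprB normcN. Qed.

Lemma normc_gt0 z : (0 < normc z) = (z != 0).
Proof.
rewrite lt_neqAle normc_ge0 andbT eq_sym; congr negb.
by apply/eqP/eqP => [/eq0_normc//|->]; exact: normc0.
Qed.

Lemma le_Re_normc z : `|complex.Re z| <= normc z.
Proof.
rewrite -(ler_pXn2r (n := 2)) ?nnegrE ?normc_ge0// normc_sqr.
by rewrite real_normK ?num_real// lerDl sqr_ge0.
Qed.

Lemma le_Im_normc z : `|complex.Im z| <= normc z.
Proof.
rewrite -(ler_pXn2r (n := 2)) ?nnegrE ?normc_ge0// normc_sqr.
by rewrite real_normK ?num_real// lerDr sqr_ge0.
Qed.

Lemma normc_le_ReIm z : normc z <= `|complex.Re z| + `|complex.Im z|.
Proof.
rewrite -(ler_pXn2r (n := 2)) ?nnegrE ?normc_ge0 ?addr_ge0// normc_sqr.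
rewrite sqrrD !real_normK ?num_real// addrAC lerDl.
by rewrite mulrn_wge0// mulr_ge0.
Qed.

Lemma normc_real a : normc a%:C = `|a|.
Proof. by rewrite /= expr0n addr0 sqrtr_sqr. Qed.

Lemma ler_dist_normc y z : `|normc y - normc z| <= normc (y - z).
Proof.
have tri u v : normc u - normc v <= normc (u - v).
  by rewrite lerBlDr -{1}(subrK v u); exact: le_normcD.
by rewrite ler_norml tri andbT lerNl opprB normcB; exact: tri.
Qed.

End ComplexModulus.

(** * Square-summable sequences *)

Section SquareSummable.
Variable R : realType.
Local Notation C := (Cplx R).
Implicit Types (x w : nat -> C).

Lemma l2sum_ge0 x : (0 <= l2sum x)%E.
Proof. by apply: nneseries_ge0 => n _ _; rewrite lee_fin sqr_ge0. Qed.

Lemma l2sum_dominated x w (M : R) :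
  (forall j, normc (x j) <= M * normc (w j)) ->
  (l2sum x <= (M ^+ 2)%:E * l2sum w)%E.
Proof.
move=> xw; rewrite /l2sum -nneseriesZl; last first.
  by move=> i _; rewrite lee_fin sqr_ge0.
apply: lee_nneseries => [i _ _|i _]; first by rewrite lee_fin sqr_ge0.
by rewrite -EFinM lee_fin -exprMn lerXn2r// ?nnegrE ?normc_ge0//
  (le_trans _ (xw i))// normc_ge0.
Qed.

Lemma ell2_dominated x w (M : R) :
  (forall j, normc (x j) <= M * normc (w j)) -> ell2 w -> ell2 x.
Proof.
move=> xw lw; rewrite /ell2/=; apply: le_lt_trans (l2sum_dominated xw) _.
have wfin : l2sum w \is a fin_num by rewrite ge0_fin_numE// l2sum_ge0.
by rewrite -(fineK wfin) -EFinM ltry.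
Qed.

Lemma l2norm_dominated x w (M : R) : 0 <= M ->
  (forall j, normc (x j) <= M * normc (w j)) -> ell2 w ->
  l2norm x <= M * l2norm w.
Proof.
move=> M0 xw lw; have lx := ell2_dominated xw lw.
have wfin : l2sum w \is a fin_num by rewrite ge0_fin_numE// l2sum_ge0.
have xfin : l2sum x \is a fin_num by rewrite ge0_fin_numE// l2sum_ge0.
have -> : M = Num.sqrt (M ^+ 2) by rewrite sqrtr_sqr ger0_norm.
rewrite /l2norm -sqrtrM ?sqr_ge0//.
rewrite ler_wsqrtr// -lee_fin EFinM !fineK//.
exact: l2sum_dominated.
Qed.

Lemma ell2D x w : ell2 x -> ell2 w -> ell2 (fun j => x j + w j).
Proof.
move=> lx lw; rewrite /ell2/=.
have sq_ge0 (u : nat -> C) i : (0 <= (normc (u i) ^+ 2)%:E)%E.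
  by rewrite lee_fin sqr_ge0.
apply: (@le_lt_trans _ _ (2%:E * (l2sum x + l2sum w))%E).
  rewrite /l2sum -nneseriesD// -nneseriesZl; last by move=> i _; rewrite adde_ge0.
  apply: lee_nneseries => [i _ _|i _]; first exact: (sq_ge0 (fun j => _)).
  rewrite -EFinD -EFinM lee_fin.
  apply: (@le_trans _ _ ((normc (x i) + normc (w i)) ^+ 2)).
    by rewrite lerXn2r// ?nnegrE ?addr_ge0 ?normc_ge0// le_normcD.
  have := sqr_ge0 (normc (x i) - normc (w i)); nra.
have wfin : l2sum w \is a fin_num by rewrite ge0_fin_numE// l2sum_ge0.
have xfin : l2sum x \is a fin_num by rewrite ge0_fin_numE// l2sum_ge0.
by rewrite -(fineK wfin) -(fineK xfin) -EFinD -EFinM ltry.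
Qed.

Lemma l2norm_scaled_basis (c : C) (j : nat) :
  l2norm (fun k => c * basis_vector R j k) = normc c.
Proof.
rewrite /l2norm /l2sum (nneseries_split 0 j.+1); last first.
  by move=> k _; rewrite lee_fin sqr_ge0.
rewrite add0n [X in (_ + X)%E]eseries0 ?adde0; last first.
  move=> k jk _; rewrite /basis_vector (gtn_eqF jk) mulr0.
  by rewrite normc0 expr0n.
rewrite sumEFin /= big_nat_recr//= big1_seq ?add0r.
  by rewrite /basis_vector eqxx mulr1 sqrtr_sqr ger0_norm ?normc_ge0.
move=> k /=; rewrite mem_index_iota /basis_vector => /ltn_eqF ->.
by rewrite mulr0 normc0 expr0n.
Qed.

Lemma l2norm_basis (j : nat) : l2norm (basis_vector R j) = 1.
Proof.
rewrite -[RHS](@normc1 R) -(l2norm_scaled_basis 1 j); congr l2norm.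
by apply/funext => k; rewrite mul1r.
Qed.

End SquareSummable.

(** * Resolvents of diagonal operators *)

Section DiagonalResolvent.
Variable R : realType.
Local Notation C := (Cplx R).
Implicit Types (a : nat -> C) (z : C).

(** Stated with the preimage c e_j given and the image computed, so that no
    division occurs and the case a j = z is included. *)
Lemma resolvent_scaled_basis a z c j :
  resolvent (diag_op a) z (fun k => (a j - z) * c * basis_vector R j k,
                           fun k => c * basis_vector R j k).
Proof.
have shiftE : (fun k => (a j - z) * c * basis_vector R j k
                        + z * (c * basis_vector R j k)) =
              (fun k => a j * c * basis_vector R j k).
  by apply/funext => k; rewrite mulrA -mulrDl -mulrDl subrK.
split => /= [||k]; first exact: ell2_scaled_basis.
  by rewrite shiftE; exact: ell2_scaled_basis.
rewrite mulrA -mulrDl -mulrDl subrK /basis_vector -mulrA.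
by case: eqP => [->//|_]; rewrite !mulr0.
Qed.

Lemma resolvent_coord a z w x j : resolvent (diag_op a) z (w, x) ->
  w j = (a j - z) * x j.
Proof. by move=> [_ _ /(_ j) /= e]; rewrite mulrBl -e addrK. Qed.

(** Since [resolvent] only asks that x and w + z x be square-summable,
    square-summability of w has to be recovered by subtraction. *)
Lemma resolvent_ell2 a z w x : resolvent (diag_op a) z (w, x) -> ell2 w.
Proof.
move=> [lx lwzx _] /=; have lzx : ell2 (fun j => - (z * x j)).
  by apply: (ell2_dominated _ lx (M := normc z)) => j; rewrite normcN normcM.
have -> : w = (fun j => (w j + z * x j) + - (z * x j)).
  by apply/funext => j; rewrite addrK.
exact: ell2D.
Qed.

Section Separated.
Variables (a : nat -> C) (z : C) (d : R).
Hypothesis d0 : 0 < d.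
Hypothesis da : forall j, d <= normc (a j - z).

Let az0 j : a j - z != 0.
Proof. by rewrite -normc_gt0 (lt_le_trans d0). Qed.

Lemma resolvent_coord_le w x j : w j = (a j - z) * x j ->
  normc (x j) <= d^-1 * normc (w j).
Proof.
move=> ->; rewrite normcM mulrA ler_peMl ?normc_ge0//.
by rewrite mulrC ler_pdivlMr// mul1r.
Qed.

Lemma resolvent_l2norm_le w x : resolvent (diag_op a) z (w, x) ->
  l2norm x <= d^-1 * l2norm w.
Proof.
move=> wx; have lw := resolvent_ell2 wx; apply: l2norm_dominated => //.
  by rewrite invr_ge0 ltW.
by move=> j; apply: resolvent_coord_le; exact: resolvent_coord.
Qed.

Lemma resolvent_bounded : bounded_everywhere (resolvent (diag_op a) z).
Proof.
split; last by exists d^-1 => w x; exact: resolvent_l2norm_le.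
move=> w lw; pose x j := w j / (a j - z).
have wE j : w j = (a j - z) * x j by rewrite mulrC divfK.
have lx : ell2 x.
  by apply: (ell2_dominated _ lw) => j; exact: resolvent_coord_le.
exists x; split.
  split => //= [|j]; last by rewrite wE -mulrDl subrK.
  apply: (@ell2_dominated _ _ w (1 + normc z * d^-1)) => // j.
  apply: le_trans (le_normcD _ _) _; rewrite mulrDl mul1r lerD2l.
  by rewrite normcM -mulrA ler_wpM2l ?normc_ge0// resolvent_coord_le.
move=> y wy; apply/funext => j; apply: (mulfI (az0 j)).
by rewrite -wE; exact: resolvent_coord wy.
Qed.

Lemma opnorm_resolvent_le : (opnorm (resolvent (diag_op a) z) <= (d^-1)%:E)%E.
Proof.
apply: ge_ereal_sup => _ [[w x] /= [wx w1] <-]; rewrite lee_fin.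
apply: le_trans (resolvent_l2norm_le wx) _.
by rewrite ler_piMr// invr_ge0 ltW.
Qed.

End Separated.

(** The condition dist(z, {a_j}) <= d, phrased without the infimum. *)
Definition near_values (d : R) a z : Prop :=
  forall e : R, 0 < e -> exists j, normc (a j - z) < d + e.

(** If the entries stay away from z, division by a j - z bounds the resolvent.
    Otherwise the basis vectors, which the resolvent stretches by the factor
    1 / |a j - z|, contradict any bound; an entry equal to z is covered too,
    since then 0 is related to a vector of norm 1. *)
Lemma spectrum_diagE a z : spectrum (diag_op a) z <-> near_values 0 a z.
Proof.
rewrite /spectrum /=; split => [unbd e e0|nz [_ [M BM]]].
  rewrite add0r; apply: contrapT => far; apply: unbd.
  apply: (resolvent_bounded e0) => j; rewrite leNgt; apply/negP => lt_e.
  by apply: far; exists j.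
have M1 j : 1 <= M * normc (a j - z).
  have := BM _ _ (resolvent_scaled_basis a z 1 j).
  by rewrite !l2norm_scaled_basis mulr1 normc1.
have M0 : 0 < M.
  rewrite ltNge; apply/negP => M0; have := M1 0%N; rewrite leNgt => /negP; apply.
  by rewrite (le_lt_trans _ ltr01)// mulr_le0_ge0 ?normc_ge0.
have [|j] := nz M^-1; first by rewrite invr_gt0.
rewrite add0r => ltM; have := M1 j; rewrite leNgt => /negP; apply.
by rewrite -ltr_pdivlMl// mulr1.
Qed.

(** The supremum defining the resolvent norm need not be attained, but a strict
    lower bound on it is witnessed by a single basis vector. *)
Lemma resolvent_norm_gt eps a z : 0 < eps ->
  ((eps^-1)%:E < resolvent_norm (diag_op a) z)%E <->
  exists j, normc (a j - z) < eps.
Proof.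
move=> eps0; rewrite /resolvent_norm; split => [|[j jz]].
  move=> big; apply: contrapT => far.
  have eps_le j : eps <= normc (a j - z).
    by rewrite leNgt; apply/negP => lt_e; apply: far; exists j.
  move: big; case: asboolP => [|_]; last first.
    by rewrite ltNge (opnorm_resolvent_le eps0 eps_le).
  by move=> + _; apply; exact: resolvent_bounded eps_le.
case: asboolP => [_|/spectrum_diagE nsp]; first exact: ltry.
have jz0 : 0 < normc (a j - z).
  rewrite normc_gt0; apply/eqP => e; apply: nsp => d d0; exists j.
  by rewrite e normc0 add0r.
apply: (@lt_le_trans _ _ ((normc (a j - z))^-1)%:E).
  by rewrite lte_fin ltf_pV2.
apply: ereal_sup_ubound.
exists (basis_vector R j, fun k => (a j - z)^-1 * basis_vector R j k).
  have := resolvent_scaled_basis a z (a j - z)^-1 j.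
  rewrite mulfV -?normc_gt0// (_ : (fun k => 1 * _) = basis_vector R j).
    by split => //=; rewrite l2norm_basis.
  by apply/funext => k; rewrite mul1r.
by rewrite /= l2norm_scaled_basis normcV.
Qed.

End DiagonalResolvent.

(** * Topology of the complex plane in terms of the real-valued modulus *)

Section ComplexTopology.
Variable R : realType.
Local Notation C := (Cplx R).

Lemma gt0_complex (e : R[i]) : 0 < e -> e = (complex.Re e)%:C /\ 0 < complex.Re e.
Proof. by case: e => a b; rewrite ltcE /= => /andP[/eqP-> ->]. Qed.

Lemma ball_normc (z y : C) (d : R) : ball z d%:C y = (normc (z - y) < d) :> Prop.
Proof.
rewrite -ball_normE /ball_ /= -[X in _ < X]/(d%:C).
by rewrite (_ : `|z - y| = (normc (z - y))%:C)// ltcR.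
Qed.

Lemma closure_normcP (A : set C) (z : C) :
  closure A z <-> forall d : R, 0 < d -> exists2 y, A y & normc (z - y) < d.
Proof.
split=> [clA d d0|near_A B].
  have [|y [Ay]] := clA (ball z d%:C).
    by apply: nbhsx_ballx; rewrite ltcR.
  by rewrite ball_normc => ?; exists y.
move=> /nbhs_ballP[e /= /gt0_complex[-> e0] eB].
have [y Ay zy] := near_A _ e0.
by exists y; split => //; apply: eB; rewrite ball_normc.
Qed.

(** Neighbourhoods of row vectors are controlled entrywise, so a modulus of
    continuity with respect to the largest entry suffices. *)
Lemma lipschitz_continuous_row m (theta : 'rV[C]_m -> C) (L : R) : 0 < L ->
  (forall (u v : 'rV[C]_m) (d : R), (forall i, normc (u 0 i - v 0 i) < d) ->
    normc (theta u - theta v) <= L * d) ->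
  continuous theta.
Proof.
move=> L0 lip u; move=> B /nbhs_ballP[e /= /gt0_complex[-> ]].
set d := complex.Re e => d0 eB.
have Ld0 : 0 < d / (2 * L) by rewrite divr_gt0// mulr_gt0.
change (nbhs u (theta @^-1` B)); apply/nbhs_ballP.
exists (d / (2 * L))%:C => /=; first by rewrite ltcR.
move=> v /= [_ uv]; apply: eB; rewrite ball_normc.
apply: (@le_lt_trans _ _ (L * (d / (2 * L)))).
  by apply: lip => i; have := uv 0 i; rewrite ball_normc.
have -> : L * (d / (2 * L)) = d / 2 by field; rewrite gt_eqF.
by rewrite gtr_pMr// invf_lt1// ltr1n.
Qed.

End ComplexTopology.

(** * Pseudospectra of diagonal operators *)

Section PseudospectrumDiag.
Variable R : realType.
Local Notation C := (Cplx R).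
Implicit Types (a : nat -> C) (z : C) (eps : R).

(** The open sublevel set is the union of the open eps-balls around the entries;
    a point at distance less than eps + d from an entry can be moved by less
    than d along the segment towards it to get within eps. *)
Lemma pseudospectrum_diagE eps a z : 0 < eps ->
  pseudospectrum eps (diag_op a) z <-> near_values eps a z.
Proof.
move=> eps0; split => [/closure_normcP cl e e0|nz].
  have [y /(resolvent_norm_gt a y eps0)[j jy] zy] := cl _ e0.
  exists j; apply: le_lt_trans (ltrD jy zy).
  have -> : a j - z = (a j - y) + (y - z) by rewrite addrA subrK.
  by rewrite (normcB z); exact: le_normcD.
apply/closure_normcP => d d0; have [j jz] := nz _ d0.
have ed0 : 0 < eps + d by rewrite addr_gt0.
(* The fraction that splits a length below eps + d into parts below d and eps. *)
pose t := d / (eps + d).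
have t0 : 0 < t by rewrite divr_gt0.
have tE : 1 - t = eps / (eps + d) by rewrite /t; field; rewrite gt_eqF.
exists (z + t%:C * (a j - z)).
  apply/(resolvent_norm_gt _ _ eps0); exists j.
  have -> : a j - (z + t%:C * (a j - z)) = (1 - t)%:C * (a j - z).
    by rewrite rmorphB /= rmorph1; ring.
  rewrite normcM normc_real tE ger0_norm ?divr_ge0 ?ltW//.
  by rewrite mulrAC ltr_pdivrMr// ltr_pM2l.
rewrite opprD addrA subrr add0r normcN normcM normc_real ger0_norm ?ltW//.
by rewrite /t mulrAC ltr_pdivrMr// ltr_pM2l.
Qed.

End PseudospectrumDiag.

(** * Moving the entries *)

Section Geometry.
Variable R : realType.
Local Notation C := (Cplx R).
Implicit Types (a : nat -> C) (eps x : R).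

Definition raise eps (c : C) : C := complex.Re c +i* (eps + `|complex.Im c|).

(** For real x the point c' = raise eps c satisfies
    |c' - x|^2 = |c - x|^2 + 2 eps |Im c| + eps^2, so the distance eps is
    approached only along entries approaching x. *)
Lemma near_values_raise eps a x : 0 < eps ->
  near_values eps (fun j => raise eps (a j)) x%:C <-> near_values 0 a x%:C.
Proof.
move=> eps0; split => near e e0; last first.
  have [j] := near _ e0; rewrite add0r => jx; exists j.
  set c := a j in jx *.
  have -> : raise eps c - x%:C
      = ((complex.Re c - x) +i* `|complex.Im c|) + (0 +i* eps).
    rewrite /raise; case: c jx => p q jx; apply/eqP; rewrite eq_complex /=.
    by rewrite oppr0 !addr0 [eps + _]addrC !eqxx.
  apply: le_lt_trans (le_normcD _ _) _; rewrite [ltRHS]addrC.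
  apply: ltr_leD; last first.
    by rewrite /= expr0n /= add0r sqrtr_sqr (ger0_norm (ltW eps0)).
  apply: le_lt_trans jx.
  by rewrite /= real_normK ?num_real//; case: c => p q /=; rewrite oppr0 addr0.
have s0 : eps < Num.sqrt (eps ^+ 2 + e ^+ 2).
  rewrite -{1}(ger0_norm (ltW eps0)) -sqrtr_sqr ltr_sqrt ?ltrDl ?exprn_gt0//.
  by rewrite addr_gt0 ?exprn_gt0.
(* |c' - x| below this square root forces |c - x| < e. *)
have [|j] := near (Num.sqrt (eps ^+ 2 + e ^+ 2) - eps).
  by rewrite subr_gt0.
rewrite addrCA subrr addr0 add0r => jx; exists j; move: jx.
rewrite -(ltr_pXn2r (n := 2)) ?nnegrE ?normc_ge0 ?sqrtr_ge0//.
rewrite -[normc (_ - _) < e](ltr_pXn2r (n := 2)) ?nnegrE ?normc_ge0 ?ltW//.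
rewrite !normc_sqr sqr_sqrtr ?addr_ge0 ?sqr_ge0//.
case: (a j) => p q /=; rewrite oppr0 !addr0.
have := mulr_ge0 (ltW eps0) (normr_ge0 q).
by rewrite -(real_normK (num_real q)); nra.
Qed.

Lemma raise_lipschitz eps (c c' : C) :
  normc (raise eps c - raise eps c') <= 2 * normc (c - c').
Proof.
apply: le_trans (normc_le_ReIm _) _ => /=.
rewrite mulr2n mulrDl mul1r lerD//.
  by have := le_Re_normc (c - c'); case: c c' => p q [].
rewrite opprD addrACA subrr add0r; apply: le_trans (ler_dist_dist _ _) _.
by have := le_Im_normc (c - c'); case: c c' => p q [].
Qed.

(** The imaginary part measures by how much c fails to be eps-close to the
    approximation q of the window; the margin 2^-m makes up for the error of q,
    so that the imaginary part is never below the excess of c over the true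
    window. *)
Definition excess eps (m : nat) (c q : C) : C :=
  complex.Re q +i*
  (Num.max (normc ((complex.Re q)%:C - c) - eps) 0 + 2 ^- m).

Lemma ler_dist_max0 (u v : R) : `|Num.max u 0 - Num.max v 0| <= `|u - v|.
Proof.
rewrite /Num.max; case: (ltP u 0) => u0; case: (ltP v 0) => v0 //.
- by rewrite subrr normr0.
- rewrite sub0r normrN (ger0_norm v0) distrC.
  by apply: le_trans (ler_norm _); rewrite lerDl oppr_ge0 ltW.
- rewrite subr0 (ger0_norm u0).
  by apply: le_trans (ler_norm _); rewrite lerDl oppr_ge0 ltW.
Qed.

Lemma excess_lipschitz eps m (c c' q q' : C) :
  normc (excess eps m c q - excess eps m c' q')
  <= 2 * normc (q - q') + normc (c - c').
Proof.
apply: le_trans (normc_le_ReIm _) _ => /=.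
have Req : `|complex.Re q - complex.Re q'| <= normc (q - q').
  by have := le_Re_normc (q - q'); case: q q' => p r [].
rewrite mulr2n mulrDl mul1r -[leRHS]addrA lerD//.
rewrite opprD addrACA subrr addr0; apply: le_trans (ler_dist_max0 _ _) _.
rewrite opprB addrA subrK.
apply: le_trans (ler_dist_normc _ _) _.
have -> : (complex.Re q)%:C - c - ((complex.Re q')%:C - c')
    = (complex.Re q - complex.Re q')%:C + (c' - c) by rewrite rmorphB /=; ring.
apply: le_trans (le_normcD _ _) _; rewrite normc_real (normcB c').
by rewrite lerD2r.
Qed.

(** Lets one sequence of diagonal entries run over all pairs of an old entry and
    a precision. *)
Definition index_pair (k : nat) : nat * nat := odflt (0, 0)%N (unpickle k).

Lemma index_pairK : cancel pickle index_pair.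
Proof. by move=> p; rewrite /index_pair pickleK. Qed.

(** If a new entry is within e of x, then so is its imaginary part from 0, and
    the margin 2^-n.+1 covers the error 2^-n.+2 made in replacing x by q n.+1,
    whence |a j - x| < eps + e.  Conversely a pair (j, n) with a j nearly
    eps-close to x and n large yields an entry close to x.  Only positive
    indices of q are controlled, hence the shift p.2.+1. *)
Lemma near_values_excess eps a x (q : nat -> C) : 0 < eps ->
  (forall n, (0 < n)%N -> normc (q n - x%:C) <= 2 ^- n.+1) ->
  near_values 0 (fun k => let p := index_pair k in
                 excess eps p.2.+1 (a p.1) (q p.2.+1)) x%:C
  <-> near_values eps a x%:C.
Proof.
move=> eps0 qx.
have Req n : `|complex.Re (q n.+1) - x| <= 2 ^- n.+2.
  apply: le_trans (qx _ (ltn0Sn n)).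
  by have := le_Re_normc (q n.+1 - x%:C); case: (q n.+1) => u v.
have pow2 n : 2 ^- n.+1 = 2 * 2 ^- n.+2 :> R.
  by rewrite [in RHS]exprS invfM mulVKf.
have Req_normc n c : `|normc ((complex.Re (q n.+1))%:C - c) - normc (c - x%:C)|
    <= 2 ^- n.+2.
  rewrite (normcB c); apply: le_trans (ler_dist_normc _ _) _.
  rewrite opprB addrA subrK -rmorphB normc_real; exact: Req.
split => near e e0.
  have [k] := near e e0.
  pose j := (index_pair k).1; pose n := (index_pair k).2.
  rewrite -[X in X - _]/(excess eps n.+1 (a j) (q n.+1)) add0r => bx; exists j.
  have := le_lt_trans (le_Im_normc _) bx.
  move/(le_lt_trans (ler_norm _)) => /=.
  rewrite oppr0 addr0 pow2; set t := 2 ^- n.+2.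
  have t0 : 0 < t by rewrite invr_gt0 exprn_gt0.
  have : normc ((complex.Re (q n.+1))%:C - a j) - eps <=
     Num.max (normc ((complex.Re (q n.+1))%:C - a j) - eps) 0.
    by rewrite le_max lexx.
  have := Req_normc n (a j); rewrite -/t ler_norml => /andP[].
  by lra.
(* The choices below bring the distance of the new entry to x under 3 e / 4:
   e / 4 from a j, e / 4 from the margin, twice e / 8 from replacing x. *)
have e4 : 0 < e / 4 by rewrite divr_gt0.
have [j jx] := near _ e4.
have [n _ ne] := @near_infty_natSinv_expn_lt R (PosNum e4).
have /= {}ne := ne n.+1 (leqnSn n).
exists (pickle (j, n)); rewrite index_pairK add0r.
rewrite -[ltLHS]/(normc (excess eps n.+1 (a j) (q n.+1) - x%:C)).
apply: le_lt_trans (normc_le_ReIm _) _ => /=; rewrite oppr0 addr0.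
have := Req n; have := Req_normc n (a j); rewrite ler_norml => /andP[_].
move: ne; rewrite div1r pow2; set t := 2 ^- n.+2.
have t0 : 0 < t by rewrite invr_gt0 exprn_gt0.
rewrite [ `|_ + 2 * t| ]ger0_norm; last first.
  by rewrite addr_ge0 ?mulr_ge0 ?(ltW t0)// le_max lexx orbT.
rewrite /Num.max; case: ifP => _; lra.
Qed.

End Geometry.

(** * Reductions between diagonal problems *)

Section Reductions.
Variable R : realType.
Local Notation C := (Cplx R).

(** The data asked of a single evaluation by a reduction with continuous
    transcripts, as a proposition: the choice is made once, when the reduction
    is built. *)
Definition continuously_reconstructed (S : sci_problem R)
    (g : instances S -> C) : Prop :=
  exists m (query : 'I_m -> instances S -> C) (theta : 'rV[C]_m -> C),
    [/\ forall i, evaluations (query i), continuous theta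
      & forall A, g A = theta (transcript query A)].

Lemma raw_fq_le_continuous_intro (S P : sci_problem R)
    (E : instances S -> instances P) (D : target_space P -> target_space S) :
  continuous D -> (forall A, D (target (E A)) = target A) ->
  (forall f : instances P -> C, evaluations f ->
     continuously_reconstructed (f \o E)) ->
  raw_fq_le_continuous S P.
Proof.
move=> Dcts DE rec.
have rc f (Lf : evaluations f) : {rc : reconstruction E f | continuous (theta rc)}.
  apply: cid; have [m [query [theta [Lq thcts fE]]]] := rec f Lf.
  have thim : set_fun (range (transcript query)) (range f) theta.
    by move=> _ [A _ <-]; exists (E A) => //; exact: fE.
  by exists (Reconstruction Lq thim fE).
exists (RawFqReduction Dcts DE (fun f Lf => sval (rc f Lf))) => f Lf /=.
by apply: continuous_subspaceT; exact: svalP (rc f Lf).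
Qed.

Section DiagonalReductions.
Variables (J : set R) (r : sgl_approximants J).

Definition diag_instance (a : nat -> C) : @Omega_diag R :=
  SigSub (mem_set (ex_intro2 _ _ a I erefl)).

Definition entries (A : @Omega_diag R) (j : nat) : C := diag_entry j (val A).

Lemma diag_op_entries (A : @Omega_diag R) : diag_op (entries A) = val A.
Proof.
have /set_mem[a _ aA] := valP A.
by rewrite -aA; congr diag_op; apply/funext => j; rewrite /entries -aA diag_entryE.
Qed.

(** The encoder keeps the window, so the approximants of the window are
    reconstructed by a single query and only the entries need attention. *)
Lemma diag_problem_reduction (S S' : operator R -> set C)
    (b : @Omega_diag R * K_sgl J -> nat -> C) :
  (forall p x, val p.2 = [set x%:C] ->
     S' (diag_op (b p)) x%:C <-> S (val p.1) x%:C) ->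
  (forall j, @continuously_reconstructed (diag_problem r S) (b ^~ j)) ->
  raw_fq_le_continuous (diag_problem r S) (diag_problem r S').
Proof.
move=> bS brec.
apply: (@raw_fq_le_continuous_intro (diag_problem r S) (diag_problem r S')
  (fun p => (diag_instance (b p), p.2)) id) => [y|p|f]; first exact: cvg_id.
- case: p => A K; rewrite /= /avoids /=; have /set_mem[x _ xK] := valP K.
  have := bS (A, K) x (esym xK); rewrite -xK /= => SE.
  apply: asbool_equiv_eq.
  have missE (U : set C) : U `&` [set x%:C] = set0 <-> ~ U x%:C.
    rewrite disjoints_subset; split=> [Ux /Ux /=|nUx y Uy]; first exact.
    by move=> yx; apply: nUx; rewrite -yx.
  by rewrite !missE SE.
- case=> [[j _ <-]|[n n0 <-]].
    have := brec j; congr continuously_reconstructed; apply/funext => p /=.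
    by rewrite /mu /= diag_entryE.
  exists 1%N, (fun=> rho r n), (fun v => v 0 0); split => [_||p].
  + by right; exists n.
  + exact: coord_continuous.
  + by rewrite /transcript mxE.
Qed.

Lemma P_sigma_le_P_sigma_eps (eps : R) : 0 < eps ->
  raw_fq_le_continuous (P_sigma r) (P_sigma_eps r eps).
Proof.
move=> eps0; rewrite /P_sigma /P_sigma_eps.
apply: (@diag_problem_reduction _ _
  (fun p j => raise eps (entries p.1 j))) => [p x _|j].
  apply: (iff_trans (pseudospectrum_diagE _ _ eps0)).
  rewrite -(diag_op_entries p.1).
  apply: iff_trans (near_values_raise _ _ eps0) _.
  exact: iff_sym (spectrum_diagE _ _).
exists 1%N, (fun=> @mu R J j), (fun v => raise eps (v 0 0)); split => [_||p].
- by left; exists j.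
- apply: (@lipschitz_continuous_row _ _ _ 2) => // u v d uv.
  apply: le_trans (raise_lipschitz _ _ _) _.
  by rewrite ler_pM2l// ltW.
- by rewrite /transcript mxE.
Qed.

Lemma P_sigma_eps_le_P_sigma (eps : R) : 0 < eps ->
  raw_fq_le_continuous (P_sigma_eps r eps) (P_sigma r).
Proof.
move=> eps0; rewrite /P_sigma /P_sigma_eps.
apply: (@diag_problem_reduction _ _
  (fun p k => let i := index_pair k in
     excess eps i.2.+1 (entries p.1 i.1) (r p.2 i.2.+1))) => [p x xK|k].
  apply: iff_trans (spectrum_diagE _ _) _.
  rewrite -(diag_op_entries p.1).
  apply: iff_trans (near_values_excess (entries p.1) eps0 _) _.
    by move=> n n0; exact: sgl_approx_close.
  exact: iff_sym (pseudospectrum_diagE _ _ eps0).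
set j := (index_pair k).1; set n := (index_pair k).2.
exists 2%N, (fun i : 'I_2 => if i == 0 then @mu R J j else rho r n.+1),
  (fun v => excess eps n.+1 (v 0 0) (v 0 1)); split => [i||p].
- by case: eqP => _; [left; exists j | right; exists n.+1].
- apply: (@lipschitz_continuous_row _ _ _ 3) => // u v d uv.
  apply: le_trans (excess_lipschitz _ _ _ _ _ _) _.
  by have := uv 0; have := uv 1; lra.
- by rewrite /transcript !mxE.
Qed.

End DiagonalReductions.
End Reductions.

Theorem theorem4p1 (R : realType) (J : set R) (r : sgl_approximants J)
    (eps : R) :
  compact J -> is_interval J -> J° !=set0 -> 0 < eps ->
  raw_fq_equiv (P_sigma r) (P_sigma_eps r eps) /\
  raw_fq_le_continuous (P_sigma r) (P_sigma_eps r eps) /\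
  raw_fq_le_continuous (P_sigma_eps r eps) (P_sigma r).
Proof.
move=> _ _ _ eps0; split; last first.
  by split; [exact: P_sigma_le_P_sigma_eps|exact: P_sigma_eps_le_P_sigma].
have [red _] := P_sigma_le_P_sigma_eps r eps0.
have [red' _] := P_sigma_eps_le_P_sigma r eps0.
by split.
Qed.
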